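(* For every integer $n\ge 0$ and all $x\in\mathbb R$, $$\sup_{SW_n\in\mathcal{SM}}\mathbb P\{SW_n\text{ visits the interval }[x,\infty)\}=D_n(x),$$ where the supremum is over all random walks based on super-martingales with differences bounded by $1$, and $D_n(x)$ is the corresponding supremum over martingales with differences bounded by $1$.
   Context: A random walk of length $n$ is $W_n=(M_0,M_1,\dots,M_n)$ with $M_0=0$, $M_k=X_1+\dots+X_k$. It visits $[x,\infty)$ if $M_k\ge x$ for some $0\le k\le n$. We write $W_n\in\mathcal M$ (respectively $W_n\in\mathcal{SM}$) if, on some probability space, there is an increasing sequence of $\sigma$-algebras $\mathcal F_0\subset\dots\subset\mathcal F_n$ to which $(M_k)$ is adapted such that $|X_m|\le 1$ and $\mathbf E(X_m\mid\mathcal F_{m-1})=0$ (respectively $|X_m|\le1$ and $\mathbf E(X_m\mid\mathcal F_{m-1})\le 0$) for all $m=1,\dots,n$. For $x\in\mathbb R$, $$D_n(x)=\sup_{W_n\in\mathcal M}\mathbb P\{W_n\text{ visits }[x,\infty)\}.$$ *)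

(* Defs.v *)
(* Library: MathComp and MathComp-Analysis. *)
From HB Require Import structures.
From mathcomp Require Import all_boot all_order all_algebra.
From mathcomp Require Import all_classical all_reals all_analysis.

Set Implicit Arguments.
Unset Strict Implicit.
Unset Printing Implicit Defensive.

Import Order.TTheory GRing.Theory Num.Theory.
Import numFieldNormedType.Exports.

Local Open Scope classical_set_scope.
Local Open Scope ring_scope.

(* Measurability with respect to a sub-sigma-algebra [G]: the measurable sets of
   [g_sigma_algebraType G] are those of [<<s G >>], which is [G] itself when [G]
   is a sigma-algebra. *)
Definition measurable_wrt (R : realType) (d : measure_display)
    (T : measurableType d) (G : set (set T)) (f : T -> R) : Prop :=
  measurable_fun [set: g_sigma_algebraType G] (f : g_sigma_algebraType G -> R).

(* [Y] is a version of E(X | G); versions are unique up to P-null sets. *)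
Definition is_condexp (R : realType) (d : measure_display)
    (T : measurableType d) (P : probability T R) (G : set (set T))
    (X Y : T -> R) : Prop :=
  [/\ P.-integrable [set: T] (EFin \o X),
      P.-integrable [set: T] (EFin \o Y),
      measurable_wrt G Y &
      forall A : set T, G A ->
        (\int[P]_(w in A) (Y w)%:E = \int[P]_(w in A) (X w)%:E)%E].

Definition filtration (d : measure_display) (T : measurableType d) (n : nat)
    (F : nat -> set (set T)) : Prop :=
  [/\ forall k, (k <= n)%N -> sigma_algebra [set: T] (F k),
      forall k, (k <= n)%N -> F k `<=` measurable &
      forall k, (k < n)%N -> F k `<=` F k.+1].

(* M_k = X_1 + ... + X_k, so M_0 = 0; [X 0] is never used. *)
Definition walk (R : realType) (T : Type) (X : nat -> T -> R) (k : nat)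
    (w : T) : R :=
  \sum_(1 <= i < k.+1) X i w.

Definition visits (R : realType) (T : Type) (n : nat) (X : nat -> T -> R)
    (x : R) : set T :=
  [set w | exists2 k, (k <= n)%N & x <= walk X k w].

(* As usual for random variables, the constraints on the differences and on
   their conditional expectations are required almost surely. *)
Definition martingale_walk (R : realType) (d : measure_display)
    (T : measurableType d) (P : probability T R) (n : nat)
    (X : nat -> T -> R) : Prop :=
  exists F : nat -> set (set T),
    [/\ filtration n F,
        forall k, (k <= n)%N -> measurable_wrt (F k) (walk X k),
        forall m, (1 <= m <= n)%N -> {ae P, forall w, `|X m w| <= 1} &
        forall m, (1 <= m <= n)%N ->
          exists2 Y : T -> R, is_condexp P (F m.-1) (X m) Y &
            {ae P, forall w, Y w = 0}].

Definition supermartingale_walk (R : realType) (d : measure_display)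
    (T : measurableType d) (P : probability T R) (n : nat)
    (X : nat -> T -> R) : Prop :=
  exists F : nat -> set (set T),
    [/\ filtration n F,
        forall k, (k <= n)%N -> measurable_wrt (F k) (walk X k),
        forall m, (1 <= m <= n)%N -> {ae P, forall w, `|X m w| <= 1} &
        forall m, (1 <= m <= n)%N ->
          exists2 Y : T -> R, is_condexp P (F m.-1) (X m) Y &
            {ae P, forall w, Y w <= 0}].

(* The suprema range over all probability spaces and are taken in [\bar R], where
   probabilities live. *)
Definition D (R : realType) (n : nat) (x : R) : \bar R :=
  ereal_sup [set p : \bar R |
    exists (d : measure_display) (T : measurableType d) (P : probability T R)
           (X : nat -> T -> R),
      martingale_walk P n X /\ p = P (visits n X x)].

Definition SD (R : realType) (n : nat) (x : R) : \bar R :=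
  ereal_sup [set p : \bar R |
    exists (d : measure_display) (T : measurableType d) (P : probability T R)
           (X : nat -> T -> R),
      supermartingale_walk P n X /\ p = P (visits n X x)].

(* Main.v *)
(* A super-martingale is dominated by a martingale on the same probability space
   and filtration.  With Y = E(X_m | F_{m-1}) <= 0, replace X_m by
     X_m' = (X_m + |Y|) / (1 + |Y|) = X_m + (1 - X_m) |Y| / (1 + |Y|),
   which moves X_m towards 1: X_m <= X_m' <= 1 almost surely, and
   E(X_m' | F_{m-1}) = 0.  Hence the new walk lies above the old one and visits
   [x, +oo[ whenever the old one does. *)
Require Import Defs.
From mathcomp Require Import all_boot all_order all_algebra.
From mathcomp Require Import all_classical all_reals all_analysis.
From mathcomp Require Import measurable_realfun ring lra.

Set Implicit Arguments.
Unset Strict Implicit.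
Unset Printing Implicit Defensive.

Import Order.TTheory GRing.Theory Num.Theory.
Import numFieldNormedType.Exports.

Local Open Scope classical_set_scope.
Local Open Scope ring_scope.

(** * Measurability for sub-sigma-algebras and bounded factors *)

Lemma measurable_wrt_sub (R : realType) (d : measure_display)
    (T : measurableType d) (G H : set (set T)) (f : T -> R) :
  G `<=` H -> measurable_wrt G f -> measurable_wrt H f.
Proof.
move=> GH mf _ B mB; have := mf measurableT B mB.
by rewrite !setTI; exact: sub_sigma_algebra2.
Qed.

Lemma measurable_wrt_measurable (R : realType) (d : measure_display)
    (T : measurableType d) (G : set (set T)) (f : T -> R) :
  G `<=` measurable -> measurable_wrt G f -> measurable_fun [set: T] f.
Proof.
move=> Gm mf _ B mB; have := mf measurableT B mB; rewrite !setTI.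
by apply: smallest_sub => //; exact: sigma_algebra_measurable.
Qed.

Lemma integrableMl_bounded (R : realType) (d : measure_display)
    (T : measurableType d) (mu : {measure set T -> \bar R}) (Z W : T -> R) :
  measurable_fun [set: T] Z -> (forall w, 0 <= Z w <= 1) ->
  mu.-integrable [set: T] (EFin \o W) ->
  mu.-integrable [set: T] (EFin \o (fun w => Z w * W w)).
Proof.
move=> mZ Z01 iW.
apply: (le_integrable _ _ _ iW) => //.
  apply/measurable_EFinP; apply: measurable_funM => //.
  exact/measurable_EFinP/(measurable_int mu).
move=> w _ /=; rewrite lee_fin normrM; have /andP[Z0 Z1] := Z01 w.
by rewrite ger0_norm// ler_piMl.
Qed.

(** * Taking out a known bounded factor *)

Section orthogonal.
Variables (R : realType) (d : measure_display) (T : measurableType d).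
Variables (mu : {measure set T -> \bar R}) (G : set (set T)) (W : T -> R).
Hypothesis Gm : G `<=` measurable.
Hypothesis iW : mu.-integrable [set: T] (EFin \o W).
Hypothesis W0 : forall A, <<s G >> A -> \int[mu]_(w in A) W w = 0.

(* Peeling off the leading binary digit of [Z], whose level sets belong to the
   sigma-algebra, halves the integral. *)
Lemma le_Rintegral_orthogonal k (Z : T -> R) :
  measurable_wrt G Z -> (forall w, 0 <= Z w <= 1) ->
  `|\int[mu]_w (Z w * W w)| <= 2^-1 ^+ k * \int[mu]_w `|W w|.
Proof.
elim: k Z => [|k IH] Z mZ Z01.
  have iZW := integrableMl_bounded (measurable_wrt_measurable Gm mZ) Z01 iW.
  rewrite expr0 mul1r (le_trans (le_normr_Rintegral _ iZW))//.
  apply: le_Rintegral => //; [exact: integrable_norm|exact: integrable_norm|].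
  move=> w _ /=; rewrite normrM; have /andP[Z0 Z1] := Z01 w.
  by rewrite ger0_norm// ler_piMl.
pose A := Z @^-1` `[2^-1, +oo[%classic.
have GA : <<s G >> A.
  have := mZ measurableT `[2^-1, +oo[%classic (measurable_itv _).
  by rewrite setTI.
have mI : measurable_wrt G (\1_A : T -> R).
  exact: (@measurable_indic _ (g_sigma_algebraType G)).
(* The binary shift of [Z]: on [A] it is [2 * Z - 1] with [Z >= 1/2], off [A] it is [2 * Z] with
   [Z < 1/2]. It thus stays in [0, 1] and [G]-measurable, as the induction hypothesis requires. *)
pose Z' w := 2 * Z w - \1_A w.
have mZ' : measurable_wrt G Z'.
  apply: (@measurable_funB _ (g_sigma_algebraType G)) => //.
  by apply: (@measurable_funM _ (g_sigma_algebraType G)).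
have Z'01 w : 0 <= Z' w <= 1.
  rewrite /Z' indicE; have := Z01 w; case: (boolP (w \in A)).
    by rewrite inE /A/= in_itv/= andbT => h1 /andP[h2 h3]/=; apply/andP; split; lra.
  rewrite notin_setE /A/= in_itv/= andbT => /negP; rewrite -ltNge => h1 /andP[h2 h3].
  by apply/andP; split; lra.
have mIT := measurable_wrt_measurable Gm mI.
have iI : mu.-integrable [set: T] (EFin \o (fun w => \1_A w * W w)).
  by apply: integrableMl_bounded => // w; rewrite indicE; case: (_ \in _) => /=; lra.
have iZ' := integrableMl_bounded (measurable_wrt_measurable Gm mZ') Z'01 iW.
have I0 : \int[mu]_w (\1_A w * W w) = 0.
  rewrite -[RHS](W0 GA) [RHS]Rintegral_mkcond; apply: eq_Rintegral => w _.
  by rewrite patchE indicE; case: ifP => _; rewrite ?mul1r ?mul0r.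
(* [Z = (Z' + \1_A) / 2], and the digit [\1_A] contributes nothing because [A] is in the
   sigma-algebra generated by [G]. *)
have -> : \int[mu]_w (Z w * W w) = 2^-1 * \int[mu]_w (Z' w * W w).
  transitivity (2^-1 * \int[mu]_w (Z' w * W w + \1_A w * W w)); last first.
    by rewrite RintegralD// I0 addr0.
  rewrite -RintegralZl//; first by apply: eq_Rintegral => w _; rewrite /Z'; field.
  by apply: eq_integrable (integrableD measurableT iZ' iI) => //.
by rewrite normrM ger0_norm ?invr_ge0// exprS -mulrA ler_pM2l ?invr_gt0// IH.
Qed.

(** Let [k] tend to infinity in the previous bound. This replaces the pull-out property of
    conditional expectation for a [W] with E(W | G) = 0. *)
Lemma Rintegral_orthogonal (Z : T -> R) :
  measurable_wrt G Z -> (forall w, 0 <= Z w <= 1) ->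
  \int[mu]_w (Z w * W w) = 0.
Proof.
move=> mZ Z01; apply/eqP; rewrite -normr_le0.
have cvg0 : 2^-1 ^+ k * \int[mu]_w `|W w| @[k --> \oo] --> (0 : R).
  rewrite -(mul0r (\int[mu]_w `|W w|)); apply: cvgMr_tmp.
  by apply: cvg_expr; rewrite ger0_norm ?invr_ge0// invf_lt1// ltr1n.
rewrite -(cvg_lim _ cvg0)//; apply: limr_ge; first exact: cvgP cvg0.
by apply: nearW => k; exact: le_Rintegral_orthogonal.
Qed.

End orthogonal.

(** * Recentring one increment *)

Lemma measurable_inv1norm (R : realType) (d : measure_display)
    (T : measurableType d) (f : T -> R) :
  measurable_fun [set: T] f ->
  measurable_fun [set: T] (fun w => (1 + `|f w|)^-1).
Proof.
have cg : continuous (fun t : R => (1 + `|t|)^-1).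
  move=> t; apply: cvgV; first by rewrite gt_eqF// ltr_pwDl.
  by apply: cvgD; [exact: cvg_cst|exact: norm_continuous].
by move=> mf; exact: (measurableT_comp (continuous_measurable_fun cg) mf).
Qed.

(** Written as a weight in [0, 1], measurable whenever [Y] is, times [X + |Y|], so that
    orthogonality applies. With [|Y|] in place of [-Y] the denominator is positive everywhere, even
    on the null set where [Y > 0], and the pointwise bounds do not depend on the sign of [Y]. *)
Definition recenter (R : realType) (T : Type) (X Y : T -> R) (w : T) : R :=
  (1 + `|Y w|)^-1 * (X w + `|Y w|).

Section recenter.
Variables (R : realType) (d : measure_display) (T : measurableType d).
Implicit Types (P : probability T R) (G : set (set T)) (X Y : T -> R).

Lemma le_recenter X Y w : X w <= 1 -> X w <= recenter X Y w.
Proof.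
move=> X1; rewrite /recenter mulrC ler_pdivlMr ?ltr_pwDl//.
(* With the denominator cleared, this is [X w * |Y w| <= |Y w|]. *)
by have := normr_ge0 (Y w); nra.
Qed.

Lemma normr_recenter_le1 X Y w : `|X w| <= 1 -> `|recenter X Y w| <= 1.
Proof.
move=> X1; have X1' : X w <= 1 by rewrite (le_trans (ler_norm _)).
rewrite ler_norml (le_trans _ (le_recenter Y X1')); last first.
  by move: X1; rewrite ler_norml => /andP[].
by rewrite /recenter mulrC ler_pdivrMr ?ltr_pwDl// mul1r lerD2r.
Qed.

Lemma measurable_wrt_recenter G X Y :
  measurable_wrt G X -> measurable_wrt G Y -> measurable_wrt G (recenter X Y).
Proof.
move=> mX mY; apply: (@measurable_funM _ (g_sigma_algebraType G)).
  exact: (@measurable_inv1norm _ _ (g_sigma_algebraType G)).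
apply: (@measurable_funD _ (g_sigma_algebraType G)) => //.
exact: (measurableT_comp (@normr_measurable R setT) mY).
Qed.

(** Almost surely [|Y| = - Y], so [X + |Y|] is [X - E(X | G)] and is orthogonal to every bounded
    [G]-measurable factor, in particular to the weight. *)
Lemma is_condexp_recenter P G X Y :
  sigma_algebra [set: T] G -> G `<=` measurable ->
  is_condexp P G X Y -> {ae P, forall w, Y w <= 0} ->
  is_condexp P G (recenter X Y) (cst 0).
Proof.
move=> sG Gm [iX iY mY XY] Y0.
have iW : P.-integrable [set: T] (EFin \o (fun w => X w + `|Y w|)).
  by apply: eq_integrable (integrableD measurableT iX (integrable_norm iY)).
pose Z w := (1 + `|Y w|)^-1.
have mZ : measurable_wrt G Z.
  exact: (@measurable_inv1norm _ _ (g_sigma_algebraType G)).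
have mZT := measurable_wrt_measurable Gm mZ.
have Z01 w : 0 <= Z w <= 1.
  by rewrite /Z invr_ge0 addr_ge0//= invf_le1 ?ltr_pwDl// lerDl.
(* On a set of [G] the integral of [X] equals that of [Y], and [Y + |Y|] vanishes almost
   everywhere. *)
have W0 A : G A -> \int[P]_(w in A) (X w + `|Y w|) = 0.
  move=> GA; have mA := Gm _ GA.
  have iXA := integrableS measurableT mA (@subsetT _ _) iX.
  have iYA := integrableS measurableT mA (@subsetT _ _) iY.
  rewrite RintegralD//; last exact: integrable_norm.
  have -> : \int[P]_(w in A) X w = \int[P]_(w in A) Y w.
    by rewrite /Rintegral XY.
  rewrite -RintegralD//; last exact: integrable_norm.
  rewrite /Rintegral (@ae_eq_integral _ _ _ _ _ (cst 0%E))//.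
  - by rewrite integral0.
  - apply/measurable_EFinP; have mYT := measurable_wrt_measurable Gm mY.
    apply: measurable_funTS; apply: measurable_funD => //.
    exact: measurableT_comp.
  - by apply: filterS Y0 => w Yw _ /=; rewrite ler0_norm// subrr.
have iR : P.-integrable [set: T] (EFin \o recenter X Y).
  exact: (integrableMl_bounded mZT Z01 iW).
split => //.
- exact: finite_measure_integrable_cst.
- exact: (@measurable_cst _ _ (g_sigma_algebraType G)).
- move=> A GA; rewrite integral0.
  have mA := Gm _ GA.
  have iRA := integrableS measurableT mA (@subsetT _ _) iR.
  rewrite -[RHS]fineK ?integrable_fin_num//; congr (_%:E).
  rewrite -/(Rintegral _ _ _) Rintegral_mkcond.
  (* The restriction to [A] is absorbed into the weight: [\1_A * Z] is again [G]-measurable with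
     values in [0, 1]. *)
  have mIZ : measurable_wrt G (fun w => \1_A w * Z w).
    apply: (@measurable_funM _ (g_sigma_algebraType G)) => //.
    apply: (@measurable_indic _ (g_sigma_algebraType G)).
    exact: sub_sigma_algebra.
  rewrite -(@Rintegral_orthogonal _ _ _ P G _ Gm iW _ _ mIZ).
  + apply: eq_Rintegral => w _; rewrite patchE indicE /recenter.
    by case: ifP => _; rewrite ?mul1r ?mul0r.
  + by move=> B; rewrite sigma_algebra_id//; exact: W0.
  + move=> w; rewrite indicE; case: (_ \in _); rewrite ?mul1r ?mul0r//.
    by rewrite lexx ler01.
Qed.

End recenter.

(** * Walks and visits *)

Lemma walk0 (R : realType) (T : Type) (X : nat -> T -> R) (w : T) :
  walk X 0 w = 0.
Proof. by rewrite /walk big_geq. Qed.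

Lemma walkS (R : realType) (T : Type) (X : nat -> T -> R) (k : nat) (w : T) :
  walk X k.+1 w = walk X k w + X k.+1 w.
Proof. by rewrite /walk big_nat_recr. Qed.

Lemma le_walk (R : realType) (T : Type) (X X' : nat -> T -> R) (n k : nat)
    (w : T) :
  (forall m, (1 <= m <= n)%N -> X m w <= X' m w) -> (k <= n)%N ->
  walk X k w <= walk X' k w.
Proof.
move=> XX' kn; rewrite /walk !big_nat; apply: ler_sum => m /andP[m1 mk].
by apply: XX'; rewrite m1 (leq_trans _ kn).
Qed.

Lemma visitsE (R : realType) (T : Type) (n : nat) (X : nat -> T -> R) (x : R) :
  visits n X x = \bigcup_(k in `I_n.+1) walk X k @^-1` `[x, +oo[.
Proof.
by apply/seteqP; split=> w [k kn xk]; exists k => //; move: xk;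
  rewrite /= in_itv /= andbT.
Qed.

Lemma measurable_visits (R : realType) (d : measure_display)
    (T : measurableType d) (n : nat) (X : nat -> T -> R) (x : R) :
  (forall k, (k <= n)%N -> measurable_fun [set: T] (walk X k)) ->
  measurable (visits n X x).
Proof.
move=> mX; rewrite visitsE; apply: bigcup_measurable => k kn.
have := mX k kn measurableT `[x, +oo[%classic (measurable_itv _).
by rewrite setTI.
Qed.

(** * Domination by a martingale *)

Section supermartingale.
Variables (R : realType) (d : measure_display) (T : measurableType d).
Implicit Types (P : probability T R) (X : nat -> T -> R).

(** Off a single null set [N], collecting the exceptional sets of all steps, the second walk lies
    above the first; hence the first event is contained in the union of the second with [N]. *)
Lemma le_visits P n X X' (x : R) :
  (forall k, (k <= n)%N -> measurable_fun [set: T] (walk X k)) ->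
  (forall k, (k <= n)%N -> measurable_fun [set: T] (walk X' k)) ->
  (forall m, (1 <= m <= n)%N -> {ae P, forall w, X m w <= X' m w}) ->
  (P (visits n X x) <= P (visits n X' x))%E.
Proof.
move=> mX mX' XX'.
have mV := measurable_visits x mX; have mV' := measurable_visits x mX'.
have : \forall w \ae P, forall m, (1 <= m <= n)%N -> X m w <= X' m w.
  apply: ae_foralln => m; case: (boolP (1 <= m <= n)%N) => [mn|_].
    by apply: filterS (XX' m mn).
  exact: aeW.
case=> N [mN N0 subN].
rewrite -[leRHS]adde0 -N0.
apply: (le_trans _ (measureU2 _ mV' mN)).
apply: le_measure; rewrite ?inE//; first exact: measurableU.
move=> w [k kn xk].
have [Nw|Nw] := pselect (N w); [by right|left; exists k => //].
apply: (le_trans xk); apply: le_walk kn.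
by apply: contrapT => nw; exact/Nw/subN.
Qed.

(** Adaptedness is given for the partial sums only; an increment is the difference of two
    consecutive ones. *)
Lemma measurable_wrt_step n (F : nat -> set (set T)) X m :
  filtration n F -> (forall k, (k <= n)%N -> measurable_wrt (F k) (walk X k)) ->
  (1 <= m <= n)%N -> measurable_wrt (F m) (X m).
Proof.
case: m => // m [sF Fm FS] mX mn.
have -> : X m.+1 = (fun w => walk X m.+1 w - walk X m w).
  by apply/funext => w; rewrite walkS addrAC subrr add0r.
apply: (@measurable_funB _ (g_sigma_algebraType (F m.+1))); first exact: mX.
by apply: (measurable_wrt_sub (FS _ mn)); apply: mX; exact: ltnW.
Qed.

Lemma measurable_wrt_walk n (F : nat -> set (set T)) X :
  filtration n F ->
  (forall m, (1 <= m <= n)%N -> measurable_wrt (F m) (X m)) ->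
  forall k, (k <= n)%N -> measurable_wrt (F k) (walk X k).
Proof.
move=> [_ _ FS] mX; elim=> [|k IH] kn.
  have -> : walk X 0 = cst 0 by apply/funext => w; rewrite walk0.
  exact: (@measurable_cst _ _ (g_sigma_algebraType (F 0))).
have -> : walk X k.+1 = (fun w => walk X k w + X k.+1 w).
  by apply/funext => w; rewrite walkS.
apply: (@measurable_funD _ (g_sigma_algebraType (F k.+1))); last exact: mX.
by apply: (measurable_wrt_sub (FS _ kn)); exact: IH (ltnW kn).
Qed.

Lemma supermartingale_walk_dominated P n X (x : R) :
  supermartingale_walk P n X ->
  exists2 X', martingale_walk P n X' &
    (P (visits n X x) <= P (visits n X' x))%E.
Proof.
move=> [F [FF mX X1 XY]]; move: (FF) => [sF Fm FS].
(* One version of the conditional expectation is fixed for each step; outside 1..n the value [X m]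
   is a mere placeholder. *)
have /choice[Y YP] : forall m, exists Y : T -> R, (1 <= m <= n)%N ->
    is_condexp P (F m.-1) (X m) Y /\ {ae P, forall w, Y w <= 0}.
  move=> m; case: (boolP (1 <= m <= n)%N) => [/XY[Y ? ?]|_]; last by exists (X m).
  by exists Y.
pose X' m := recenter (X m) (Y m).
have mX' : forall k, (k <= n)%N -> measurable_wrt (F k) (walk X' k).
  apply: (measurable_wrt_walk FF) => m mn.
  apply: measurable_wrt_recenter; first exact: measurable_wrt_step FF mX mn.
  (* [Y m] is measurable for the earlier [F m.-1], hence for [F m]. *)
  have [[_ _ mY _] _] := YP m mn; case: m mn mY {YP} => // m mn mY.
  exact: measurable_wrt_sub (FS _ mn) mY.
exists X'.
  exists F; split => // m mn.
    by apply: filterS (X1 m mn) => w; exact: normr_recenter_le1.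
  have [cY Y0] := YP m mn; exists (cst 0); last exact: aeW.
  have mn' : (m.-1 <= n)%N by case/andP: mn => _; exact: leq_trans (leq_pred _).
  exact: is_condexp_recenter (sF _ mn') (Fm _ mn') cY Y0.
apply: le_visits => [k kn|k kn|m mn].
- exact: measurable_wrt_measurable (Fm _ kn) (mX _ kn).
- exact: measurable_wrt_measurable (Fm _ kn) (mX' _ kn).
- apply: filterS (X1 m mn) => w /ler_normlP[_ ?]; exact: le_recenter.
Qed.

Lemma martingale_walk_supermartingale P n X :
  martingale_walk P n X -> supermartingale_walk P n X.
Proof.
move=> [F [FF mX X1 XY]]; exists F; split => // m /XY[Y cY Y0].
by exists Y => //; apply: filterS Y0 => w ->.
Qed.

End supermartingale.

Theorem theorem2 (R : realType) (n : nat) (x : R) : SD n x = D n x.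
Proof.
apply/eqP; rewrite eq_le; apply/andP; split; apply: ub_ereal_sup => _
  [d [T [P [X [hX ->]]]]].
  (* Each supermartingale probability is at most that of a dominating martingale on the same space,
     so the suprema compare. *)
  have [X' mX' /le_trans] := supermartingale_walk_dominated x hX; apply.
  by apply: ereal_sup_ubound; exists d, T, P, X'.
apply: ereal_sup_ubound; exists d, T, P, X; split => //.
exact: martingale_walk_supermartingale.
Qed.
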